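(* Let $\mathbf u$ be an infinite word over a finite alphabet whose language is closed under reversal. Then $D(\mathbf u)<+\infty$ if and only if $\sum_{n=0}^{+\infty}T_{\mathbf u}(n)<+\infty$.
   Context: For a finite word $w=w_0\cdots w_{n-1}$ its reversal is $\overline{w}=w_{n-1}\cdots w_0$; $w$ is a palindrome if $w=\overline{w}$ (the empty word is a palindrome). The language $\mathcal L(\mathbf u)$ is the set of all finite factors of $\mathbf u$, and $\mathcal L_n(\mathbf u)$ those of length $n$; the language is closed under reversal if $w\in\mathcal L(\mathbf u)$ implies $\overline w\in\mathcal L(\mathbf u)$. The factor complexity is $\mathcal C_{\mathbf u}(n)=\#\mathcal L_n(\mathbf u)$ and the palindromic complexity $\mathcal P_{\mathbf u}(n)$ is the number of palindromes in $\mathcal L_n(\mathbf u)$. Define $T_{\mathbf u}(n)=\mathcal C_{\mathbf u}(n+1)-\mathcal C_{\mathbf u}(n)+2-\mathcal P_{\mathbf u}(n+1)-\mathcal P_{\mathbf u}(n)$ (it is known that $T_{\mathbf u}(n)\ge 0$ for such words). The defect of a finite word $w$ is $D(w)=|w|+1-(\text{number of distinct palindromic factors of } w, \text{ including the empty word})$. The defect of an infinite word is $D(\mathbf u)=\sup\{D(w): w \text{ a prefix of } \mathbf u\}$ (possibly $+\infty$). *)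

(* Defs.v *)
From mathcomp Require Import all_boot.
From mathcomp Require Import boolp.
From mathcomp Require Import all_order ssralg ssrnum ssrint.
Import Order.TTheory GRing.Theory Num.Theory.
Set Implicit Arguments. Unset Strict Implicit. Unset Printing Implicit Defensive.

Section Words.
Variable A : finType.

Definition factor (u : nat -> A) (w : seq A) : Prop :=
  exists i, w = [seq u (i + j) | j <- iota 0 (size w)].

Definition closed_under_reversal (u : nat -> A) : Prop :=
  forall w : seq A, factor u w -> factor u (rev w).

Definition palindrome (w : seq A) : bool := rev w == w.

Definition fcompl (u : nat -> A) (n : nat) : nat :=
  #|[set t : n.-tuple A | `[< factor u t >]]|.

Definition pcompl (u : nat -> A) (n : nat) : nat :=
  #|[set t : n.-tuple A | `[< factor u t >] && palindrome t]|.

Definition Tu (u : nat -> A) (n : nat) : int :=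
  ((fcompl u n.+1)%:Z - (fcompl u n)%:Z + 2 - (pcompl u n.+1)%:Z
     - (pcompl u n)%:Z)%R.

Definition factors_of (w : seq A) : seq (seq A) :=
  [seq take j (drop i w) | i <- iota 0 (size w).+1, j <- iota 0 (size w - i).+1].

Definition npal (w : seq A) : nat :=
  size (undup [seq x <- factors_of w | palindrome x]).

Definition defect (w : seq A) : int := ((size w).+1%:Z - (npal w)%:Z)%R.

Definition prefix (u : nat -> A) (n : nat) : seq A := [seq u j | j <- iota 0 n].

(* D(u) < +oo : the sup of the defects of prefixes is finite *)
Definition finite_defect (u : nat -> A) : Prop :=
  exists B : int, forall n, (defect (prefix u n) <= B)%R.

(* sum_{n>=0} T_u(n) < +oo (as an absolutely convergent series of integers) *)
Definition T_summable (u : nat -> A) : Prop :=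
  exists B : int, forall N, (\sum_(0 <= n < N) `|Tu u n| <= B)%R.

End Words.

(* Main.v *)
Require Import Defs.
From mathcomp Require Import all_boot boolp all_order ssralg ssrnum ssrint.
From mathcomp Require Import zify.
Import Order.TTheory Num.Theory.
Set Implicit Arguments.
Unset Strict Implicit.
Unset Printing Implicit Defensive.

(* Let G_n be the graph whose vertices are the factors of length n up to
   reversal and whose edges are the non-palindromic factors of length n+1 up to
   reversal (palindromes would be loops). Since the language is closed under
   reversal, T(n) / 2 = #edges - #vertices + 1. Reading u from left to right is
   a walk through all of G_n, and a vertex other than the first one is always
   discovered along an edge discovered at the same time. So T(n) / 2 counts the
   positions k at which the walk discovers an edge leading to a vertex already
   visited.
   Now fix m. Among the suffixes of u_0 ... u_m, those with no earlier
   occurrence up to reversal are the long ones; let u_k ... u_m be the shortest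
   of them. It is a palindrome iff u_m creates a new palindrome; otherwise it is
   an edge of G_(m-k) of the kind counted by T(m-k), and no other suffix is.
   Counting the pairs (k, m) in two ways gives sum_n T(n) = 2 D(u). *)

Lemma big_nat_antidiagonals (R : Type) (idx : R) (op : Monoid.com_law idx)
    (F : nat -> nat -> R) M :
  \big[op/idx]_(0 <= m < M) \big[op/idx]_(0 <= k < m.+1) F (m - k) k =
  \big[op/idx]_(0 <= n < M) \big[op/idx]_(0 <= k < M - n) F n k.
Proof.
elim: M => [|M IH]; first by rewrite !big_geq.
rewrite big_nat_recr //= {}IH.
rewrite [RHS](eq_big_nat _ _ (F2 := fun n =>
    op (\big[op/idx]_(0 <= k < M - n) F n k) (F n (M - n)))) => [|n /andP[_ ?]].
  rewrite big_split /=; congr (op _ _).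
    by rewrite big_nat_recr //= subnn [X in op _ X]big_geq // Monoid.mulm1.
  rewrite big_nat_rev; apply: eq_big_nat => k /andP[_ kM].
  by rewrite add0n subSS subKn.
by rewrite subSn // big_nat_recr.
Qed.

Lemma leq_sum_nat_widen m n (F : nat -> nat) : m <= n ->
  \sum_(0 <= i < m) F i <= \sum_(0 <= i < n) F i.
Proof. exact: (le_big_nat leqnn (fun x y => leq_addr y x)). Qed.

Section OrbitVisits.
Variables (T : finType) (f : T -> T) (x : nat -> T).
Hypothesis fK : involutive f.

Definition seen k : {set T} :=
  [set y | (y \in mkseq x k) || (f y \in mkseq x k)].

Definition first_visit k := x k \notin seen k.

Lemma inv_seen k y : (f y \in seen k) = (y \in seen k).
Proof. by rewrite !inE fK orbC. Qed.

Lemma seenS k : seen k.+1 = x k |: (f (x k) |: seen k).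
Proof.
apply/setP => y; rewrite inE mkseqS !mem_rcons !inE.
by rewrite (inv_eq fK); case: (y == x k); case: (y == f (x k)); rewrite ?orbT.
Qed.

(* The orbit of [x k] under [f] has [(f (x k) != x k).+1] elements. *)
Lemma sum_seen (g : T -> nat) K : (forall y, g (f y) = g y) ->
  \sum_(y in seen K) g y =
  \sum_(0 <= k < K) first_visit k * ((f (x k) != x k).+1 * g (x k)).
Proof.
move=> gf; elim: K => [|K IH].
  by rewrite big_geq // big1 // => y; rewrite inE.
rewrite big_nat_recr //= -{}IH seenS /first_visit.
have [seen_xK|new_xK] /= := boolP (x K \in seen K).
  have /setUidPr -> : [set f (x K)] \subset seen K by rewrite sub1set inv_seen.
  have /setUidPr -> : [set x K] \subset seen K by rewrite sub1set.
  by rewrite addn0.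
have [->|fx] /= := eqVneq (f (x K)) (x K).
  by rewrite setUA setUid big_setU1 //= !mul1n addnC.
rewrite !big_setU1 ?gf /=; first by lia.
  by rewrite inv_seen.
by rewrite in_setU1 negb_or eq_sym fx.
Qed.

End OrbitVisits.

Lemma suffix_comparable (T : eqType) (x y w : seq T) :
  suffix x w -> suffix y w -> size x <= size y -> suffix x y.
Proof.
move=> suf_x /[dup] /size_suffix le_yw; rewrite suffixE => /eqP yE le_xy.
by rewrite suffixE -{2}yE drop_drop addnC addnBA // subnK // -suffixE.
Qed.

Lemma suffix_size_inj (T : eqType) (x y w : seq T) :
  suffix x w -> suffix y w -> size x = size y -> x = y.
Proof. by rewrite !suffixE => /eqP xE /eqP yE sizeE; rewrite -xE sizeE yE. Qed.

Section FiniteWords.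
Variable A : finType.
Implicit Types (w x y p : seq A) (a : A).

Lemma mem_factors_of w x : (x \in factors_of w) = infix x w.
Proof.
apply/idP/infixP => [/allpairsPdep[i [j [_ _ ->]]]|[s [s' ->]]].
  exists (take i w), (drop j (drop i w)).
  by rewrite !cat_take_drop.
apply/allpairsPdep; exists (size s), (size x); split.
- by rewrite mem_iota add0n ltnS size_cat /= leq_addr.
- by rewrite mem_iota add0n ltnS !size_cat addKn /= leq_addr.
- by rewrite drop_size_cat // take_size_cat.
Qed.

Definition palindromes_of w := undup [seq x <- factors_of w | palindrome x].

Lemma mem_palindromes_of w x :
  (x \in palindromes_of w) = palindrome x && infix x w.
Proof. by rewrite mem_undup mem_filter mem_factors_of. Qed.

Definition new_palindrome p a :=
  has (fun x => x \notin palindromes_of p) (palindromes_of (rcons p a)).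

Lemma palindromes_of_rconsD p a x :
  (x \in palindromes_of (rcons p a)) && (x \notin palindromes_of p) =
  [&& palindrome x, suffix x (rcons p a) & ~~ infix x p].
Proof.
rewrite !mem_palindromes_of infix_rconsl.
by case: palindrome; case: suffix; case: infix.
Qed.

Lemma new_palindromeP p a :
  reflect (exists x, [/\ palindrome x, suffix x (rcons p a) & ~~ infix x p])
          (new_palindrome p a).
Proof.
apply: (iffP hasP) => [[x x_pa x_p]|[x new_x]].
  by exists x; apply/and3P; rewrite -palindromes_of_rconsD x_pa.
by move/and3P: new_x; rewrite -palindromes_of_rconsD => /andP[]; exists x.
Qed.

(* A palindromic suffix of the palindrome y is also a prefix of y. *)
Lemma infix_palindromic_suffix p a x y :
    palindrome x -> palindrome y -> suffix x y -> size x < size y ->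
  suffix y (rcons p a) -> infix x p.
Proof.
move=> /eqP pal_x /eqP pal_y xy lt_xy /suffixP[s paE].
have /prefixP[z yE] : prefix x y by rewrite -suffix_rev pal_x pal_y.
move: lt_xy paE; rewrite {}yE.
case/lastP: z => [|z b _]; first by rewrite cats0 ltnn.
by rewrite -!rcons_cat => /rcons_inj[-> _]; apply: infix_infix.
Qed.

Lemma new_palindrome_uniq p a x y :
    x \in palindromes_of (rcons p a) -> x \notin palindromes_of p ->
    y \in palindromes_of (rcons p a) -> y \notin palindromes_of p ->
  x = y.
Proof.
wlog le_xy : x y / size x <= size y => [IH|] x_pa x_p y_pa y_p.
  by have [/IH|/ltnW/IH eq_yx] := leqP (size x) (size y); last apply/esym; auto.
have := palindromes_of_rconsD p a x; have := palindromes_of_rconsD p a y.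
rewrite x_pa x_p y_pa y_p.
move=> /esym/and3P[pal_y suf_y _] /esym/and3P[pal_x suf_x new_x].
move: le_xy; rewrite leq_eqVlt => /orP[/eqP|lt_xy].
  exact: suffix_size_inj suf_x suf_y.
have suf_xy := suffix_comparable suf_x suf_y (ltnW lt_xy).
by rewrite (infix_palindromic_suffix pal_x pal_y suf_xy lt_xy suf_y) in new_x.
Qed.

Lemma sub_palindromes_of_rcons p a :
  {subset palindromes_of p <= palindromes_of (rcons p a)}.
Proof.
move=> x; rewrite !mem_palindromes_of infix_rconsl => /andP[-> ->].
by rewrite orbT.
Qed.

Lemma npal_rcons p a : npal (rcons p a) = npal p + new_palindrome p a.
Proof.
rewrite -![npal _]/(size (palindromes_of _)).
have [/hasP[x x_pa x_p]|/hasPn old] := boolP (new_palindrome p a).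
  rewrite addn1 -[RHS]/(size (x :: palindromes_of p)).
  apply/perm_size/uniq_perm; rewrite /= ?x_p ?undup_uniq // => y; rewrite inE.
  apply/idP/orP => [y_pa|[/eqP-> //|/sub_palindromes_of_rcons //]].
  have [y_p|y_p] := boolP (y \in palindromes_of p); [by right|left].
  by apply/eqP; apply: new_palindrome_uniq y_pa y_p x_pa x_p.
rewrite addn0; apply/perm_size/uniq_perm; rewrite ?undup_uniq // => y.
by apply/idP/idP => [/old/negPn //|/sub_palindromes_of_rcons].
Qed.

Definition trev n (w : n.-tuple A) : n.-tuple A := [tuple of rev w].

Lemma trevK n : involutive (@trev n).
Proof. by move=> w; apply: val_inj; rewrite /= revK. Qed.

Lemma palindrome_trev n (w : n.-tuple A) : palindrome (trev w) = palindrome w.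
Proof. by rewrite /palindrome /= revK eq_sym. Qed.

End FiniteWords.

Section Windows.
Variables (A : finType) (u : nat -> A).

Definition window i n : seq A := mkseq (fun j => u (i + j)) n.

Lemma size_window i n : size (window i n) = n.
Proof. exact: size_mkseq. Qed.

Lemma windowSr i n : window i n.+1 = rcons (window i n) (u (i + n)).
Proof. exact: mkseqS. Qed.

Lemma windowD i m n : window i (m + n) = window i m ++ window (i + m) n.
Proof.
elim: n => [|n IH]; first by rewrite addn0 cats0.
by rewrite addnS !windowSr IH rcons_cat addnA.
Qed.

Lemma windowSl i n : window i n.+1 = u i :: window i.+1 n.
Proof. by rewrite -add1n windowD /window /= addn0 addn1. Qed.

Lemma drop_window i n d : drop d (window i n) = window (i + d) (n - d).
Proof.
have [dn|/ltnW nd] := leqP d n; last first.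
  by rewrite (eqP nd) drop_oversize // size_window.
by rewrite -{1}(subnKC dn) windowD drop_size_cat // size_window.
Qed.

Lemma take_window i n d : d <= n -> take d (window i n) = window i d.
Proof.
by move=> dn; rewrite -(subnKC dn) windowD take_size_cat // size_window.
Qed.

Lemma suffix_windowP (x : seq A) i n :
  reflect (exists2 d, d <= n & x = window (i + d) (n - d))
          (suffix x (window i n)).
Proof.
apply: (iffP idP) => [|[d dn ->]]; last by rewrite -drop_window suffix_drop.
rewrite suffixE size_window drop_window => /eqP <-.
by exists (n - size x); rewrite ?leq_subr.
Qed.

Lemma infix_windowP (x : seq A) i n :
  reflect (exists2 d, d + size x <= n & x = window (i + d) (size x))
          (infix x (window i n)).
Proof.
apply: (iffP idP) => [/infixP[s [s' winE]]|[d dn xE]].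
  have nE : size s + (size x + size s') = n.
    by rewrite -!size_cat -winE size_window.
  exists (size s); first by lia.
  move/(congr1 (take (size x) \o drop (size s))): winE => /=.
  rewrite drop_size_cat // take_size_cat // drop_window take_window //.
  by rewrite -nE addKn leq_addr.
apply/infixP; exists (window i d), (window (i + d + size x) (n - (d + size x))).
by rewrite {1}xE -!windowD; congr window; lia.
Qed.

Lemma rev_palindrome_window i d n :
  palindrome (window i (d + n)) -> rev (window (i + d) n) = window i n.
Proof.
rewrite /palindrome windowD rev_cat -windowD (addnC d) windowD.
by rewrite eqseq_cat ?size_rev ?size_window // => /andP[/eqP].
Qed.

Definition new_palindrome_at m := new_palindrome (window 0 m) (u m).

Lemma new_palindrome_atP m :
  reflect (exists a, [/\ a <= m.+1, palindrome (window a (m.+1 - a)) &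
            forall i, i < a -> window i (m.+1 - a) <> window a (m.+1 - a)])
          (new_palindrome_at m).
Proof.
apply: (iffP (new_palindromeP _ _)); rewrite -windowSr.
  move=> [x [pal_x /suffix_windowP[a am xE] new_x]]; rewrite add0n in xE.
  exists a; rewrite -xE; split=> // i ia occ_i.
  case/infix_windowP: new_x; exists i; rewrite xE size_window; first by lia.
  by rewrite add0n -xE.
move=> [a [am pal_a first_a]]; exists (window a (m.+1 - a)); split=> //.
  by apply/suffix_windowP; exists a.
apply/infix_windowP => -[i]; rewrite size_window add0n => im /esym.
by apply: first_a; lia.
Qed.

Lemma npal_prefix m :
  npal (Defs.prefix u m) + \sum_(0 <= i < m) ~~ new_palindrome_at i = m.+1.
Proof.
elim: m => [|m IH]; first by rewrite big_geq.
rewrite big_nat_recr //= -[Defs.prefix _ _]/(window 0 m.+1) windowSr npal_rcons.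
rewrite -/(new_palindrome_at m) -[window 0 m]/(Defs.prefix u m).
by case: new_palindrome_at => /=; lia.
Qed.

Lemma defect_prefix m :
  defect (Defs.prefix u m) = Posz (\sum_(0 <= i < m) ~~ new_palindrome_at i).
Proof. by rewrite /defect size_map size_iota -(npal_prefix m); lia. Qed.

Definition twindow i n : n.-tuple A := Tuple (introT eqP (size_window i n)).

Definition fresh k n := first_visit (@trev A n) (twindow^~ n) k.

Lemma freshP k n :
  reflect (forall i, i < k ->
             window i n <> window k n /\ window i n <> rev (window k n))
          (fresh k n).
Proof.
rewrite /fresh /first_visit inE negb_or.
apply: (iffP andP) => [[/mapP new_w /mapP new_rev] i ik|new].
  by split=> occ; [apply: new_w|apply: new_rev]; exists i;
    rewrite ?mem_iota //; apply: val_inj; rewrite /= occ.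
by split; apply/mapP => -[i]; rewrite mem_iota => /new[? ?] /(congr1 val)/esym.
Qed.

Lemma fresh_start n : fresh 0 n.
Proof. exact/freshP. Qed.

Lemma fresh_nil k : fresh k.+1 0 = false.
Proof. by apply/freshP => /(_ 0 isT)[]. Qed.

Lemma freshS k n : fresh k.+1 n -> fresh k n.+1.
Proof.
move=> /freshP new; apply/freshP => i ik; split.
  by rewrite !windowSl => -[_]; case: (new i.+1).
rewrite windowSr windowSl rev_cons => /rcons_inj[].
by case: (new i (leqW ik)).
Qed.

Lemma fresh_extend d k n : fresh (k + d) n -> fresh k (d + n).
Proof.
by elim: d k => [|d IH] k; rewrite ?addn0 // addnS -addSn => /IH/freshS.
Qed.

Lemma fresh_nonpalindrome k n : fresh k.+1 n -> ~~ palindrome (window k n.+1).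
Proof.
move=> /freshP/(_ k (ltnSn k))[_ new_rev].
apply/negP => pal; apply: new_rev.
by rewrite -addn1 rev_palindrome_window.
Qed.

(* In the graph G_n, the walk takes at time k the edge [window k n.+1] from the
   vertex [window k n] to the vertex [window k.+1 n]. *)
Definition closes_cycle k n :=
  [&& fresh k n.+1, ~~ palindrome (window k n.+1) & ~~ fresh k.+1 n].

Lemma fresh_nonpalindromeE k n :
  fresh k n.+1 && ~~ palindrome (window k n.+1) =
  fresh k.+1 n + closes_cycle k n :> nat.
Proof.
rewrite /closes_cycle; case: (boolP (fresh k.+1 n)) => [new|_].
  by rewrite freshS // fresh_nonpalindrome.
by rewrite andbT.
Qed.

Definition last_fresh m k0 :=
  k0 <= m /\ forall k, k <= m.+1 -> fresh k (m.+1 - k) = (k <= k0).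

Lemma last_fresh_exists m : exists k0, last_fresh m k0.
Proof.
have ex_k : exists k, (k <= m) && fresh k (m.+1 - k).
  by exists 0; apply: fresh_start.
have le_m k : (k <= m) && fresh k (m.+1 - k) -> k <= m by case/andP.
case: (ex_maxnP ex_k le_m) => k0 /andP[k0m fresh_k0] max_k0.
exists k0; split=> // k km; apply/idP/idP => [fresh_k|kk0].
  apply: max_k0; rewrite fresh_k andbT -ltnS ltn_neqAle km andbT.
  by apply: contraTneq fresh_k => ->; rewrite subnn fresh_nil.
have -> : m.+1 - k = (k0 - k) + (m.+1 - k0) by lia.
by apply: fresh_extend; rewrite subnKC.
Qed.

Lemma new_palindrome_at_last_fresh m k0 : last_fresh m k0 ->
  new_palindrome_at m = palindrome (window k0 (m.+1 - k0)).
Proof.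
move=> [k0m freshE].
have /freshP new_k0 : fresh k0 (m.+1 - k0) by rewrite freshE // leqW.
apply/new_palindrome_atP/idP => [[a [am pal_a first_a]]|pal_k0]; last first.
  by exists k0; split=> // [|i /new_k0[]]; first exact: leqW.
have ak0 : a <= k0.
  by rewrite -freshE //; apply/freshP => i /first_a; rewrite (eqP pal_a).
move: ak0; rewrite leq_eqVlt => /orP[/eqP <- //|ak0].
have [_ []] := new_k0 a ak0.
rewrite -(@rev_palindrome_window a (k0 - a)) ?(subnKC (ltnW ak0)) //.
by have -> : k0 - a + (m.+1 - k0) = m.+1 - a by lia.
Qed.

Lemma closes_cycle_last_fresh m k0 k : last_fresh m k0 -> k <= m ->
  closes_cycle k (m - k) = (k == k0) && ~~ new_palindrome_at m.
Proof.
move=> last_k0 km; rewrite (new_palindrome_at_last_fresh last_k0).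
case: last_k0 => _ freshE; rewrite /closes_cycle -subSn // -[m - k]subSS.
rewrite (freshE k (leqW km)) (freshE k.+1 km) -ltnNge ltnS andbCA -eqn_leq.
by case: (eqVneq k k0) => [->|_]; rewrite ?andbT ?andbF.
Qed.

Lemma sum_closes_cycle m :
  \sum_(0 <= k < m.+1) closes_cycle k (m - k) = ~~ new_palindrome_at m.
Proof.
have [k0 last_k0] := last_fresh_exists m; have [k0m _] := last_k0.
rewrite big_mkord (bigD1 (Ordinal (k0m : k0 < m.+1))) //=.
rewrite (closes_cycle_last_fresh last_k0) // eqxx big1 ?addn0 // => k ne_k.
rewrite (closes_cycle_last_fresh last_k0) -1?ltnS //.
by have /negPf -> : (k : nat) != k0 := ne_k.
Qed.

Lemma defect_closes_cycle m :
  defect (Defs.prefix u m) =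
  Posz (\sum_(0 <= n < m) \sum_(0 <= k < m - n) closes_cycle k n).
Proof.
rewrite defect_prefix.
rewrite -(big_nat_antidiagonals _ (fun n k => closes_cycle k n : nat)).
by congr Posz; apply: eq_bigr => i _; rewrite sum_closes_cycle.
Qed.

End Windows.

Section Complexity.
Variables (A : finType) (u : nat -> A).

Definition language n : {set n.-tuple A} :=
  [set w : n.-tuple A | `[< factor u w >]].

Lemma languageP n (w : n.-tuple A) :
  reflect (exists i, w = twindow u i n) (w \in language n).
Proof.
rewrite inE; apply: (iffP (asboolP _)) => [[i]|[i ->]].
  by rewrite size_tuple => wE; exists i; apply: val_inj.
by exists i; rewrite size_window.
Qed.

Definition covers K n := language n = seen (@trev A n) ((twindow u)^~ n) K.

Lemma fcomplE n : fcompl u n = \sum_(w in language n) 1.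
Proof. by rewrite sum1_card. Qed.

Lemma pcomplE n : pcompl u n = \sum_(w in language n) palindrome w.
Proof.
rewrite /pcompl -sum1_card big_mkcond [RHS]big_mkcond /=.
by apply: eq_bigr => w _; rewrite !inE; case: asboolP; case: palindrome.
Qed.

Lemma sum_language n K (g : n.-tuple A -> nat) :
    covers K n -> (forall w, g (trev w) = g w) ->
  \sum_(w in language n) g w =
  \sum_(0 <= k < K)
    fresh u k n * ((~~ palindrome (window u k n)).+1 * g (twindow u k n)).
Proof. by move=> -> g_trev; rewrite (sum_seen _ (@trevK A n)). Qed.

Lemma fcompl_add_pcompl n K : covers K n ->
  fcompl u n + pcompl u n = 2 * \sum_(0 <= k < K) fresh u k n.
Proof.
move=> covK; rewrite fcomplE pcomplE -big_split /=.
rewrite (sum_language covK) => [|w]; last by rewrite palindrome_trev.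
rewrite big_distrr /=; apply: eq_bigr => k _.
by case: palindrome; lia.
Qed.

Lemma fcompl_nonpalindrome n K : covers K n ->
  fcompl u n =
  pcompl u n +
  2 * \sum_(0 <= k < K) (fresh u k n && ~~ palindrome (window u k n)).
Proof.
move=> covK.
have -> : fcompl u n = pcompl u n + \sum_(w in language n) ~~ palindrome w.
  rewrite fcomplE pcomplE -big_split /=.
  by apply: eq_bigr => w _; case: palindrome.
congr addn; rewrite (sum_language covK) => [|w];
  last by rewrite palindrome_trev.
rewrite big_distrr /=; apply: eq_bigr => k _.
by case: palindrome; case: fresh.
Qed.

Lemma Tu_closes_cycle n K : covers K.+1 n -> covers K n.+1 ->
  Tu u n = Posz (2 * \sum_(0 <= k < K) closes_cycle u k n).
Proof.
move=> /fcompl_add_pcompl + /fcompl_nonpalindrome.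
under [in X in _ -> X -> _]eq_bigr do rewrite fresh_nonpalindromeE.
by rewrite big_nat_recl //= fresh_start big_split /Tu /=; lia.
Qed.

Hypothesis u_closed : closed_under_reversal u.

Lemma eventually_covers n : exists K0, forall K, K0 <= K -> covers K n.
Proof.
have /choice[pos posP] : forall w, exists i,
    w \in language n -> w = twindow u i n.
  by move=> w; have [[i ->]|] := languageP w; [exists i|exists 0].
exists (\max_w pos w).+1 => K maxK; apply/setP => w; apply/idP/idP => [wL|].
  rewrite inE; apply/orP; left; apply/mapP; exists (pos w); last exact: posP.
  by rewrite mem_iota (leq_trans _ maxK) // ltnS leq_bigmax.
rewrite inE => /orP[]/mapP[i _ wE]; first by apply/languageP; exists i.
have : factor u (trev w) by rewrite wE; exists i; rewrite size_window.
by move=> /u_closed; rewrite /= revK inE => ?; apply/asboolP.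
Qed.

Lemma sum_Tu_closes_cycle N : exists K0, forall K, K0 <= K ->
  (\sum_(0 <= n < N) `|Tu u n|)%R =
  Posz (2 * \sum_(0 <= n < N) \sum_(0 <= k < K) closes_cycle u k n).
Proof.
have [K0 covK0] := choice eventually_covers.
exists (\max_(n < N.+1) K0 n) => K maxK.
have covK n k : n <= N -> K <= k -> covers k n.
  rewrite -ltnS => nN Kk; apply/covK0/(leq_trans _ Kk)/(leq_trans _ maxK).
  exact: (leq_bigmax (Ordinal nN)).
rewrite big_distrr /= (big_morph Posz PoszD (erefl _)).
apply: eq_big_nat => n /andP[_ nN].
by rewrite (Tu_closes_cycle (K := K)) ?ger0_norm //; apply: covK; lia.
Qed.

Lemma defect_le_sum_Tu m :
  (2 * defect (Defs.prefix u m) <= \sum_(0 <= n < m) `|Tu u n|)%R.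
Proof.
have [K0 sumE] := sum_Tu_closes_cycle m.
rewrite defect_closes_cycle (sumE (maxn K0 m)) ?leq_maxl //.
rewrite PoszM ler_pM2l // lez_nat; apply: leq_sum => n _.
by apply: leq_sum_nat_widen; rewrite (leq_trans (leq_subr _ _)) ?leq_maxr.
Qed.

Lemma sum_Tu_le_defect N : exists m,
  (\sum_(0 <= n < N) `|Tu u n| <= 2 * defect (Defs.prefix u m))%R.
Proof.
have [K /(_ K (leqnn K)) ->] := sum_Tu_closes_cycle N.
exists (N + K); rewrite defect_closes_cycle PoszM ler_pM2l // lez_nat.
apply: (@leq_trans
  (\sum_(0 <= n < N) \sum_(0 <= k < N + K - n) closes_cycle u k n)).
  rewrite !big_mkord; apply: leq_sum => n _; have nN := ltn_ord n.
  by apply: leq_sum_nat_widen; lia.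
exact/leq_sum_nat_widen/leq_addr.
Qed.

End Complexity.

Theorem theorem2 (A : finType) (u : nat -> A) :
  closed_under_reversal u -> (finite_defect u <-> T_summable u).
Proof.
move=> u_closed; split=> -[B boundB].
  exists (2 * B)%R => N; have [m le_m] := sum_Tu_le_defect u_closed N.
  by apply: le_trans le_m _; rewrite ler_pM2l.
exists B => m; have := boundB m; have := defect_le_sum_Tu u_closed m.
rewrite defect_prefix; lia.
Qed.
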